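(* Let $G=(Q,E,\delta,q_0)$ be a deterministic automaton over a finite event set $E$ with uncontrollable events $E_{uc}\subseteq E$, let $d$ be a metric on $E$ with values in $[0,1]$, and let $\lambda\in[0,1]$. A language $K\subseteq L(G)$ is $\lambda$-controllable if and only if $d(B(K,\lambda)^{\uparrow},K)\leq\lambda$.
   Context: Setting. $E$ is a finite set of events, partitioned as $E=E_c\sqcup E_{uc}$ (controllable / uncontrollable events); $E^*$ is the set of finite strings over $E$ including the empty string $\epsilon$; $l(s)$ is the length of a string $s$; $\overline{L}$ is the prefix closure of a language $L\subseteq E^*$. $G=(Q,E,\delta,q_0)$ is a deterministic automaton with partial transition function $\delta:Q\times E\to Q$, extended to strings as usual, and $L(G)=\{s\in E^*:\delta(q_0,s)\text{ is defined}\}$ (a prefix closed language containing $\epsilon$). Metrics. $d$ is a metric on $E$ with values in $[0,1]$. Set $d(\epsilon,\epsilon)=0$ and $d(a,\epsilon)=d(\epsilon,a)=1$ for $a\in E$. For strings $s=s_1\cdots s_{l(s)}$, $t=t_1\cdots t_{l(t)}$, pad the shorter one with $\epsilon$'s and define $d(s,t)=\sum_{i=1}^{\max\{l(s),l(t)\}}2^{-i}d(s_i,t_i)$. For a string $s$ and a language $A$, $d(s,A)=\inf_{a\in A}d(s,a)$ if $A\neq\emptyset$ and $d(s,\emptyset)=1$. For languages $A,B$, $d(A,B)$ is the Hausdorff metric: $d(\emptyset,\emptyset)=0$, and otherwise $d(A,B)=\max\{\sup_{a\in A}d(a,B),\sup_{b\in B}d(b,A)\}$ (a supremum over the empty set being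 $0$). Balls. For $s\in L(G)$, $B(s,\lambda)=\{t\in L(G):d(s,t)\le\lambda\}$, and for $K\subseteq L(G)$, $B(K,\lambda)=\bigcup_{s\in K}B(s,\lambda)$. Controllability. A language $K\subseteq L(G)$ is controllable if $\overline{K}E_{uc}\cap L(G)\subseteq\overline{K}$. $K^{\uparrow}$ denotes the supremal (largest) controllable sublanguage of $K$, i.e. the union of all controllable $M\subseteq K$. A language $K\subseteq L(G)$ is $\lambda$-controllable if there is a controllable language $\widetilde K\subseteq L(G)$ with $d(\widetilde K,K)\le\lambda$; such a $\widetilde K$ is called a realization of $K$. *)

(* Defs.v *)
From HB Require Import structures.
From mathcomp Require Import all_boot all_order all_algebra.
From mathcomp Require Import boolp classical_sets reals.

Set Implicit Arguments.
Unset Strict Implicit.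
Unset Printing Implicit Defensive.

Import Order.TTheory GRing.Theory Num.Theory.

Local Open Scope classical_set_scope.
Local Open Scope ring_scope.

(* The state space may be infinite; [trans q e = None] means that delta(q, e)
   is undefined. *)
Record automaton (E : Type) := Automaton {
  state : Type;
  trans : state -> E -> option state;
  init : state
}.

Section Languages.
Variables (E : Type) (G : automaton E).

Definition trans_str (q : state G) (s : seq E) : option (state G) :=
  foldl (fun oq e => obind (fun q' => trans q' e) oq) (Some q) s.

Definition generated : set (seq E) := [set s | trans_str (init G) s].

End Languages.

Definition prefix_closure (E : eqType) (L : set (seq E)) : set (seq E) :=
  [set s | exists2 t, L t & prefix s t].

Section Controllability.
Variables (E : eqType) (G : automaton E) (Euc : set E).

Definition controllable (K : set (seq E)) : Prop :=
  K `<=` generated G /\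
  [set rcons s e | s in prefix_closure K & e in Euc] `&` generated G
    `<=` prefix_closure K.

Definition sup_controllable (K : set (seq E)) : set (seq E) :=
  \bigcup_(M in [set M | controllable M /\ M `<=` K]) M.

End Controllability.

Section Metrics.
Variable R : realType.

Definition is_metric (T : Type) (d : T -> T -> R) : Prop :=
  [/\ forall a b, 0 <= d a b,
      forall a b, d a b = 0 <-> a = b,
      forall a b, d a b = d b a &
      forall a b c, d a c <= d a b + d b c].

Section StringMetric.
Variables (E : Type) (d : E -> E -> R).

(* [None] plays the role of the padding symbol epsilon. *)
Definition dist_eps (a b : option E) : R :=
  match a, b with
  | Some a, Some b => d a b
  | None, None => 0
  | _, _ => 1
  end.

(* Positions are numbered from 0, whence the weight 2^-(i+1); [onth s i] is
   [None] beyond the end of [s]. *)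
Definition dist_str (s t : seq E) : R :=
  \sum_(i < maxn (size s) (size t))
    2 ^- i.+1 * dist_eps (onth s i) (onth t i).

Definition dist_str_lang (s : seq E) (A : set (seq E)) : R :=
  if A == set0 then 1 else inf [set dist_str s a | a in A].

(* When the event distance takes values in [0, 1], all the sets below are
   bounded by 1, so that [sup] is the genuine supremum; [sup set0 = 0]. *)
Definition dist_lang (A B : set (seq E)) : R :=
  if (A == set0) && (B == set0) then 0
  else Num.max (sup [set dist_str_lang a B | a in A])
               (sup [set dist_str_lang b A | b in B]).

End StringMetric.

Section LambdaControllability.
Variables (E : eqType) (d : E -> E -> R) (G : automaton E).

Definition ball_str (s : seq E) (lambda : R) : set (seq E) :=
  [set t | generated G t /\ dist_str d s t <= lambda].

Definition ball_lang (K : set (seq E)) (lambda : R) : set (seq E) :=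
  \bigcup_(s in K) ball_str s lambda.

Definition lambda_controllable (Euc : set E) (lambda : R)
    (K : set (seq E)) : Prop :=
  exists K' : set (seq E),
    controllable G Euc K' /\ dist_lang d K' K <= lambda.

End LambdaControllability.
End Metrics.

(* Main.v *)
(* The point is that, although a language may be infinite, the infimum defining
   d(s, A) is attained: among the words of A with a given pattern on the first
   l(s) positions, the distance to s increases with the length, and there are
   finitely many patterns. Hence every realization of K lies in B(K, lambda),
   so in its supremal controllable sublanguage, which can only be closer to
   the words of K. *)
Require Import Defs.
From HB Require Import structures.
From mathcomp Require Import all_boot all_order all_algebra.
From mathcomp Require Import boolp classical_sets reals.
From mathcomp Require Import lra.

Set Implicit Arguments.
Unset Strict Implicit.
Unset Printing Implicit Defensive.

Import Order.TTheory GRing.Theory Num.Theory.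

Local Open Scope classical_set_scope.
Local Open Scope ring_scope.

Section Distance.
Variables (R : realType) (E : finType) (d : E -> E -> R).
Hypothesis d_sym : forall a b, d a b = d b a.
Hypothesis d01 : forall a b, 0 <= d a b <= 1.

Lemma dist_eps_sym (a b : option E) : dist_eps d a b = dist_eps d b a.
Proof. by case: a b => [a|] [b|] /=. Qed.

Lemma dist_eps_ge0 (a b : option E) : 0 <= dist_eps d a b.
Proof. by case: a b => [a|] [b|] //=; have /andP[] := d01 a b. Qed.

Lemma dist_eps_le1 (a b : option E) : dist_eps d a b <= 1.
Proof. by case: a b => [a|] [b|] //=; have /andP[] := d01 a b. Qed.

Lemma dist_str_sym (s t : seq E) : dist_str d s t = dist_str d t s.
Proof.
by rewrite /dist_str maxnC; apply: eq_bigr => i _; rewrite dist_eps_sym.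
Qed.

Lemma dist_str_ge0 (s t : seq E) : 0 <= dist_str d s t.
Proof.
apply: sumr_ge0 => i _.
by rewrite mulr_ge0 ?dist_eps_ge0 // invr_ge0 exprn_ge0.
Qed.

Lemma sum_exprV2 (n : nat) : \sum_(i < n) 2 ^- i.+1 = 1 - 2 ^- n :> R.
Proof.
elim: n => [|n IHn]; first by rewrite big_ord0 expr0 invr1 subrr.
rewrite big_ord_recr /= IHn exprS invfM.
lra.
Qed.

Lemma dist_str_le1 (s t : seq E) : dist_str d s t <= 1.
Proof.
apply: (@le_trans _ _ (\sum_(i < maxn (size s) (size t)) 2 ^- i.+1)).
  apply: ler_sum => i _.
  by rewrite ler_piMr ?dist_eps_le1 // invr_ge0 exprn_ge0.
by rewrite sum_exprV2 gerBl invr_ge0 exprn_ge0.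
Qed.

(** Extra padding compares epsilon with epsilon and adds only zero terms. A common length [n] lets
    distances between different pairs of strings be compared term by term. *)
Lemma dist_str_widen (n : nat) (s t : seq E) :
  (maxn (size s) (size t) <= n)%N ->
  dist_str d s t = \sum_(i < n) 2 ^- i.+1 * dist_eps d (onth s i) (onth t i).
Proof.
move=> le_n; rewrite /dist_str.
pose F i : R := 2 ^- i.+1 * dist_eps d (onth s i) (onth t i).
rewrite (big_ord_widen n F le_n).
rewrite [RHS](bigID (fun i : 'I_n => i < maxn (size s) (size t))%N) /=.
rewrite [X in _ + X]big1 ?addr0 // => i; rewrite -leqNgt geq_max => /andP[si ti].
by rewrite !onth_default // mulr0.
Qed.

(** Past the end of [s] a letter costs the full 1 against the padding, whichever letter it is, so
    there only the length counts. *)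
Lemma dist_str_le_size (s a b : seq E) :
  (forall i, (i < size s)%N -> onth a i = onth b i) -> (size a <= size b)%N ->
  dist_str d s a <= dist_str d s b.
Proof.
move=> eq_ab le_ab; rewrite [leRHS]/dist_str.
rewrite (@dist_str_widen (maxn (size s) (size b))); last first.
  by rewrite geq_max leq_maxl (leq_trans le_ab) ?leq_maxr.
apply: ler_sum => i _; apply: ler_wpM2l; first by rewrite invr_ge0 exprn_ge0.
case: (ltnP i (size s)) => [/eq_ab -> //|si]; rewrite (onth_default si).
case: (ltnP i (size a)) => [ia|ia]; last by rewrite (onth_default ia) dist_eps_ge0.
have := leq_trans ia le_ab; rewrite -!onthTE.
by case: (onth b i) => // ? _; case: (onth a i).
Qed.

Lemma dist_str_argmin (s : seq E) (A : set (seq E)) : A !=set0 ->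
  exists2 a, A a & forall b, A b -> dist_str d s a <= dist_str d s b.
Proof.
move=> [a0 Aa0].
(* The pattern of a word on the positions of [s], with [None] past its end; as [E] is finite, there
   are finitely many patterns. *)
pose key (a : seq E) := [ffun i : 'I_(size s) => onth a i].
have shortest (k : {ffun 'I_(size s) -> option E}) : exists a, A a /\
    forall b, A b -> key b = k -> key a = k /\ (size a <= size b)%N.
  have [[b [Ab kb]]|nob] := pselect (exists b, A b /\ key b = k); last first.
    (* For a pattern that no word of [A] has, any element of [A] serves as representative. *)
    by exists a0; split=> // b Ab kb; case: nob; exists b.
  have ex_size : exists n, `[< exists a, [/\ A a, key a = k & size a = n] >].
    by exists (size b); apply/asboolP; exists b.
  case: (ex_minnP ex_size) => n /asboolP[a [Aa ka <-]] min_a.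
  exists a; split=> // c Ac kc; split=> //.
  by apply: min_a; apply/asboolP; exists c.
have [rep repP] := choice shortest.
pose F k := dist_str d s (rep k).
case: (@arg_minP _ _ _ (key a0) predT F isT) => k _ min_k.
exists (rep k); first by have [] := repP k.
move=> b Ab; apply: le_trans (min_k (key b) isT) _.
have [_ /(_ b Ab erefl)[eq_key le_size]] := repP (key b).
apply: dist_str_le_size => // i si.
by have /ffunP/(_ (Ordinal si)) := eq_key; rewrite !ffunE.
Qed.

Lemma dist_str_lang_le (s a : seq E) (A : set (seq E)) :
  A a -> dist_str_lang d s A <= dist_str d s a.
Proof.
move=> Aa; rewrite /dist_str_lang; case: eqP => [A0|_].
  by move: Aa; rewrite A0.
apply: ge_inf; last by exists a.
by exists 0 => _ [b _ <-]; exact: dist_str_ge0.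
Qed.

Lemma dist_str_lang_attained (s : seq E) (A : set (seq E)) : A !=set0 ->
  exists2 a, A a & dist_str d s a = dist_str_lang d s A.
Proof.
move=> A0; have [a Aa min_a] := dist_str_argmin s A0; exists a => //.
apply/le_anti; rewrite dist_str_lang_le // andbT /dist_str_lang.
case: eqP => [_|_]; first exact: dist_str_le1.
by apply: lb_le_inf; [exists (dist_str d s a), a|move=> _ [b Ab <-]; exact: min_a].
Qed.

Lemma dist_str_lang_le1 (s : seq E) (A : set (seq E)) :
  dist_str_lang d s A <= 1.
Proof.
have [->|/set0P[a Aa]] := eqVneq A set0; first by rewrite /dist_str_lang eqxx.
exact: le_trans (dist_str_lang_le s Aa) (dist_str_le1 s a).
Qed.

(** For empty [A] this rests on the convention that the distance to the empty language is 1, the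
    upper bound of all distances. *)
Lemma dist_str_lang_anti (s : seq E) (A B : set (seq E)) :
  A `<=` B -> dist_str_lang d s B <= dist_str_lang d s A.
Proof.
move=> AB; have [->|/set0P A0] := eqVneq A set0.
  by rewrite [leRHS]/dist_str_lang eqxx dist_str_lang_le1.
have [a Aa <-] := dist_str_lang_attained s A0.
exact/dist_str_lang_le/AB.
Qed.

(** The bound 1 on distances makes the supremum genuine; [0 <= r] covers empty [A], where it is
    0. *)
Lemma sup_dist_str_lang_le (A B : set (seq E)) (r : R) : 0 <= r ->
  sup [set dist_str_lang d a B | a in A] <= r <->
  forall a, A a -> dist_str_lang d a B <= r.
Proof.
move=> r0; split=> [le_r a Aa|le_r].
  apply: le_trans le_r; apply: ub_le_sup; last by exists a.
  by exists 1 => _ [b _ <-]; exact: dist_str_lang_le1.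
have [->|/set0P[a Aa]] := eqVneq A set0; first by rewrite image_set0 sup0.
apply: ge_sup; first by exists (dist_str_lang d a B), a.
by move=> _ [b Ab <-]; exact: le_r.
Qed.

Lemma dist_lang_le (A B : set (seq E)) (r : R) : 0 <= r ->
  dist_lang d A B <= r <->
  (forall a, A a -> dist_str_lang d a B <= r) /\
  (forall b, B b -> dist_str_lang d b A <= r).
Proof.
move=> r0; rewrite /dist_lang; case: ifP => [/andP[/eqP-> /eqP->] //|_].
rewrite ge_max; split=> [/andP[AB BA]|[AB BA]].
  by split; apply/sup_dist_str_lang_le.
by apply/andP; split; apply/sup_dist_str_lang_le.
Qed.

End Distance.

Lemma sup_controllable_sub (E : eqType) (G : automaton E) (Euc : set E)
    (K : set (seq E)) : sup_controllable G Euc K `<=` K.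
Proof. by move=> s [M [_ MK] /MK]. Qed.

(** A prefix of a word of the union is a prefix of a word of a single member [M], and the
    controllability of [M] supplies the extension. *)
Lemma sup_controllable_controllable (E : eqType) (G : automaton E)
    (Euc : set E) (K : set (seq E)) :
  controllable G Euc (sup_controllable G Euc K).
Proof.
split=> [s [M [[MG _] _] /MG] //|_ [[s [t [M [[MG Mc] MK] Mt] st] [e eE <-]] Gse]].
have [|u Mu su] := Mc (rcons s e).
  by split=> //; exists s; [exists t|exists e].
by exists u => //; exists M.
Qed.

Theorem theorem1 (R : realType) (E : finType) (G : automaton E) (Euc : set E)
    (d : E -> E -> R) (lambda : R) (K : set (seq E))
    (d_metric : is_metric d) (d01 : forall a b : E, 0 <= d a b <= 1)
    (lambda01 : 0 <= lambda <= 1) (K_sub : K `<=` generated G) :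
  lambda_controllable d G Euc lambda K <->
  dist_lang d (sup_controllable G Euc (ball_lang d G K lambda)) K <= lambda.
Proof.
have [_ _ d_sym _] := d_metric; have /andP[lambda0 _] := lambda01.
(* For the converse, the supremal sublanguage is itself a realization. *)
split=> [[K' [K'c /(dist_lang_le d01 _ _ lambda0)[K'K KK']]]|]; last first.
  exists (sup_controllable G Euc (ball_lang d G K lambda)).
  by split=> //; exact: sup_controllable_controllable.
apply/(dist_lang_le d01 _ _ lambda0); split=> [a /sup_controllable_sub|b Kb].
  move=> [s Ks [_ le_sa]]; apply: le_trans (dist_str_lang_le d01 a Ks) _.
  by rewrite (dist_str_sym d_sym).
(* Enlarging a language brings it closer to [b], so it suffices to embed [K'] in the supremal
   sublanguage, that is, in the ball. *)
apply: le_trans (KK' b Kb); apply: (dist_str_lang_anti d01) => a K'a.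
exists K' => //; split=> // c K'c'.
(* Attainment yields a centre [s] in [K] at distance exactly d(c, K), hence at most [lambda]; a mere
   infimum would not. *)
have [|s Ks eq_cs] := dist_str_lang_attained d01 c (A := K); first by exists b.
exists s => //; split; first by case: K'c => + _; apply.
by rewrite (dist_str_sym d_sym) eq_cs K'K.
Qed.
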